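(* Let $R$ be a finite group with an abelian subgroup $M$ of index $2$. Then the number of subsets $S$ of $R\setminus M$ such that $\mathrm{Cay}(R,S)$ is a DRR (i.e. $\mathrm{Aut}(\mathrm{Cay}(R,S))=R$) is at least $$2^{\frac{|R|}{2}}-5\cdot 2^{\frac{3|R|}{8}+\log_2|R|\cdot \log_2(|R|/2)}.$$
   Context: For a group $R$ and $S\subseteq R$, the Cayley digraph $\mathrm{Cay}(R,S)$ has vertex set $R$ and $(g,h)$ is an arc if and only if $gh^{-1}\in S$. The group $R$ acts regularly on it as a group of automorphisms by right multiplication, and is identified with a subgroup of $\mathrm{Aut}(\mathrm{Cay}(R,S))$. $\mathrm{Cay}(R,S)$ is a DRR (digraphical regular representation) if $\mathrm{Aut}(\mathrm{Cay}(R,S))=R$. When $S\subseteq R\setminus M$ for a subgroup $M$ of index 2, the digraph is bipartite with bipartition $\{M,R\setminus M\}$. *)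

(* Defs.v *)
From mathcomp Require Import all_boot all_order all_algebra all_fingroup.
From mathcomp Require Import reals exp.

Set Implicit Arguments.
Unset Strict Implicit.
Unset Printing Implicit Defensive.

Import Order.TTheory GRing.Theory Num.Theory.

Local Open Scope group_scope.

Section Digraph.

Variable T : finType.

(* A digraph on T is given by its arc relation; loops are allowed. *)
Definition dgAut (e : rel T) : {set {perm T}} :=
  [set s : {perm T} | [forall x, forall y, e (s x) (s y) == e x y]].

Lemma dgAutP (e : rel T) (s : {perm T}) :
  reflect (forall x y, e (s x) (s y) = e x y) (s \in dgAut e).
Proof.
rewrite inE; apply: (iffP forallP) => [es x y | es x].
  by have /forallP/(_ y)/eqP := es x.
by apply/forallP=> y; rewrite es.
Qed.

Lemma dgAut_group_set (e : rel T) : group_set (dgAut e).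
Proof.
apply/group_setP; split=> [|s t /dgAutP es /dgAutP et].
  by apply/dgAutP=> x y; rewrite !perm1.
by apply/dgAutP=> x y; rewrite !permM et es.
Qed.

Canonical dgAut_group (e : rel T) : {group {perm T}} :=
  Group (dgAut_group_set e).

End Digraph.

Section Cayley.

Variable gT : finGroupType.

Definition Cay (S : {set gT}) : rel gT := [rel g h | g * h^-1 \in S].

(* The permutations x |-> x * a of gT, for a in gT. *)
Definition rreg : {group {perm gT}} := (actperm 'R @* [set: gT])%G.

Lemma rregP (s : {perm gT}) :
  reflect (exists a, forall x, s x = x * a) (s \in rreg).
Proof.
apply: (iffP morphimP) => [[a _ _ ->] | [a sa]].
  by exists a => x; rewrite actpermE.
by exists a; rewrite ?inE //; apply/permP=> x; rewrite actpermE sa.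
Qed.

Lemma rreg_sub_Aut (S : {set gT}) : rreg \subset dgAut (Cay S).
Proof.
apply/subsetP=> s /rregP[a sa]; apply/dgAutP=> x y; rewrite /Cay /=.
by rewrite !sa invgM mulgA mulgK.
Qed.

Definition is_DRR (S : {set gT}) : bool := dgAut (Cay S) == rreg.

End Cayley.

Definition log2 (K : realType) (x : K) : K := (ln x / ln 2)%R.

(* Main.v *)
(* Let A be the automorphism group of Cay(R, S). If S generates R, the stabilizer
   of 1 in A preserves M; if in addition A > R, then A contains a group G in
   which the regular group M is a proper maximal subgroup and which preserves M.
   An element of G fixing 1 leaves S invariant, because S is the set of
   in-neighbours of 1.

   - If M is normal in G, a nontrivial g in G fixing 1 satisfies
     g(xm) = g(x)g(m) for m in M. There are at most |M|^(1 + log2 |M|) such maps,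
     and each fixes at most half of R \ M, hence leaves at most 2^(3|M|/4) sets
     invariant.
   - Otherwise N = M :&: Z(G) equals M :&: M :^ g for every g outside M, so G / N
     is a Frobenius group with complement M / N. Its kernel E is N * G_x for every
     point x, since it is the set of elements lying in no conjugate of M \ N and
     the cardinals agree. Each e in E acts on the coset xN as the translation by
     some shift(x, e) in N, so S is invariant on yN under the translations by
     shift(y, e) for e in E fixing 1. At most one coset yN in R \ M escapes a
     nontrivial translation, and this remains true modulo any subgroup L of N that
     does not contain all the shifts. When the translations are involutions, L is
     taken of index 2 in the elementary abelian group they live in; without this
     refinement there would be too many candidate involutions when N = (Z/2)^3.

   If S does not generate R, it is empty or lies in a coset of a proper subgroup
   of M. *)

Require Import Defs.
From mathcomp Require Import all_boot all_order all_algebra all_fingroup.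
From mathcomp Require Import cyclic pgroup abelian frobenius.
From mathcomp Require Import zify ring.
From mathcomp Require Import reals exp.

Set Implicit Arguments.
Unset Strict Implicit.
Unset Printing Implicit Defensive.

(** * Stable subsets and generating sequences *)

Section StableSubsets.

Variables (T : finType) (s : {perm T}) (A : {set T}).

Definition stable_subsets : {set {set T}} :=
  [set X : {set T} | (X \subset A) && [forall x, (s x \in X) == (x \in X)]].

Lemma stable_expg (X : {set T}) i x :
  (forall y, (s y \in X) = (y \in X)) -> ((s ^+ i)%g x \in X) = (x \in X).
Proof.
by move=> sX; elim: i => [|i IH]; rewrite ?expg0 ?perm1 // expgSr permM sX.
Qed.

(** A stable set is the union of the orbits that it meets. *)
Lemma card_stable_subsets_orbits :
  #|stable_subsets| <= 2 ^ #|porbit s @: A|.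
Proof.
rewrite -card_powerset.
have inj : {in stable_subsets &, injective (fun X : {set T} => porbit s @: X)}.
  move=> X Y; rewrite !inE => /andP[_ /forallP sX] /andP[_ /forallP sY] eXY.
  suff sub (U V : {set T}) : (forall x, (s x \in V) == (x \in V)) ->
      porbit s @: U = porbit s @: V -> U \subset V.
    by apply/eqP; rewrite eqEsubset !sub.
  move=> sV eUV; apply/subsetP=> x Ux.
  have : porbit s x \in porbit s @: V by rewrite -eUV imset_f.
  case/imsetP=> y Vy /eqP; rewrite eq_porbit_mem => /porbitP[i ->].
  by rewrite stable_expg // => z; exact/eqP.
rewrite -(card_in_imset inj); apply: subset_leq_card.
apply/subsetP=> _ /imsetP[X + ->]; rewrite !inE => /andP[XA _].
exact: imsetS.
Qed.

Hypothesis sA : forall x, (s x \in A) = (x \in A).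

Lemma card_stable_subsets_order d :
  0 < d -> {in A, forall x, d <= #|porbit s x|} ->
  #|stable_subsets| <= 2 ^ (#|A| %/ d).
Proof.
move=> d0 dA; apply: leq_trans card_stable_subsets_orbits _.
rewrite leq_exp2l // leq_divRL // -[#|A|]sum1_card.
rewrite (partition_big_imset (porbit s)) /= -sum_nat_const; apply: leq_sum => _ /imsetP[x Ax ->].
apply: leq_trans (dA x Ax) _; rewrite sum1_card; apply: subset_leq_card.
apply/subsetP=> y yx; rewrite unfold_in /= eq_porbit_mem yx andbT.
by have /porbitP[i ->] := yx; rewrite stable_expg.
Qed.

Lemma card_stable_subsets_fix f :
  #|[set x in A | s x == x]| <= f ->
  #|stable_subsets| <= 2 ^ ((#|A| + f) %/ 2).
Proof.
move=> fixA; apply: leq_trans card_stable_subsets_orbits _.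
rewrite leq_exp2l // leq_divRL //.
apply: leq_trans (leq_add (leqnn _) fixA).
rewrite -[#|A|]sum1_card -[X in _ + X]sum1_card.
rewrite [X in _ + X](eq_bigl (fun x => (x \in A) && (s x == x))); last by move=> x; rewrite inE.
rewrite big_mkcondr -big_split (partition_big_imset (porbit s)) /= -sum_nat_const.
apply: leq_sum => _ /imsetP[x Ax ->].
(* A fixed point counts twice in the sum; any other orbit contains both [x] and [s x]. *)
rewrite (bigD1 x) ?Ax ?eqxx //=; case: eqP => [_|/eqP sxx]; first by lia.
rewrite (bigD1 (s x)) /=; first by lia.
by rewrite sA Ax sxx andbT eq_porbit_mem (mem_porbit s 1 x).
Qed.

End StableSubsets.

Lemma card_subsets_blocks (T : finType) (A : {set T}) (P : {set {set T}})
    (F : {set T} -> {set {set T}}) :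
  A \subset cover P ->
  #|[set S : {set T} | (S \subset A) && [forall (B | B \in P), S :&: B \in F B]]|
    <= \prod_(B in P) #|F B|.
Proof.
(* The default [set0] off [P] leaves a single choice there. *)
move=> AP; pose G B : pred {set T} := fun X => if B \in P then X \in F B else X == set0.
pose h S := [ffun B : {set T} => if B \in P then S :&: B else set0].
set X := [set S | _].
have inj : {in X &, injective h}.
  suff sub S S' : S \in X -> h S = h S' -> S \subset S'.
    by move=> S S' XS XS' e; apply/eqP; rewrite eqEsubset !sub.
  rewrite inE => /andP[SA _] e; apply/subsetP=> x Sx.
  have /bigcupP[B PB Bx] := subsetP AP x (subsetP SA x Sx).
  have := congr1 (fun g : {ffun {set T} -> {set T}} => x \in g B) e.
  by rewrite !ffunE PB !inE Sx Bx !andbT => /esym.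
rewrite -(card_in_imset inj).
suff -> : \prod_(B in P) #|F B| = #|family G|.
  apply: subset_leq_card; apply/subsetP=> _ /imsetP[S + ->].
  rewrite inE => /andP[_ /forallP SF]; apply/familyP=> B; rewrite ffunE unfold_in /G.
  by have := SF B; case: (B \in P) => //= _; rewrite eqxx.
rewrite (card_family G) foldrE big_map big_enum /= big_mkcond /=.
apply: eq_bigr => B _; case: ifP => PB.
  by apply: eq_card => Y; rewrite unfold_in /G PB.
by rewrite -[LHS](card1 (set0 : {set T})); apply: eq_card => Y; rewrite [LHS]unfold_in /G PB [RHS]unfold_in.
Qed.

Lemma leq_card_bigcup (I T : finType) (A : {pred I}) (F : I -> {set T}) :
  #|\bigcup_(i in A) F i| <= \sum_(i in A) #|F i|.
Proof.
elim/big_rec2: _ => [|i n X _ leXn]; first by rewrite cards0.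
by apply: leq_trans (leq_add (leqnn _) leXn); rewrite cardsU leq_subr.
Qed.

(** * Short generating sequences *)

Section Generation.

Variable gT : finGroupType.
Implicit Types H K N : {group gT}.

(** By Lagrange, each new generator at least doubles the order; hence the logarithm in the final
    exponent. *)
Lemma gen_seq H K : H \subset K ->
  exists2 s : seq gT, {subset s <= K} & 2 ^ size s * #|H| <= #|K| /\ <<H :|: [set x in s]>>%g = K.
Proof.
have [n] := ubnP (#|K| - #|H|); elim: n H => // n IH H leKn sHK.
have [eHK|neHK] := eqVneq (H : {set gT}) K.
  exists [::] => //; rewrite eHK mul1n; split=> //.
  by rewrite set_nil setU0 genGid.
have /properP[_ [x Kx nHx]] : H \proper K by rewrite properEneq neHK.
pose J := (H <*> <[x]>)%G.
have [sHJ Jx] : H \subset J /\ x \in J.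
  by split; rewrite ?joing_subl // mem_gen // inE cycle_id orbT.
have sJK : J \subset K by rewrite join_subG sHK cycle_subG.
have two : 2 * #|H| <= #|J|.
  rewrite -(Lagrange sHJ) mulnC leq_pmul2l // indexg_gt1.
  by apply: contra nHx => /subsetP; apply.
have h0 := cardG_gt0 H; have hK := subset_leq_card sJK.
have [||s sK [les gen]] := IH J => //; first by lia.
exists (x :: s) => [y|]; first by rewrite inE => /predU1P[->|/sK].
split=> [|]; first by apply: leq_trans les; rewrite /= expnS -mulnA mulnCA leq_mul2l two orbT.
rewrite -[RHS]gen; apply/eqP; rewrite eqEsubset !gen_subG; apply/andP; split.
  apply/subsetP=> y; rewrite !inE => /or3P[Hy|/eqP->|sy]; apply: mem_gen; rewrite !inE.
  - by rewrite (subsetP sHJ).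
  - by rewrite Jx.
  - by rewrite sy orbT.
apply/subsetP=> y; rewrite inE => /orP[|]; last first.
  by rewrite inE => sy; apply: mem_gen; rewrite !inE sy !orbT.
apply/subsetP; rewrite join_subG cycle_subG; apply/andP; split.
  by apply/subsetP=> z Hz; rewrite mem_gen // !inE Hz.
by rewrite mem_gen // !inE eqxx orbT.
Qed.

End Generation.

(** * Non-normal maximal abelian subgroups *)

Section MaximalAbelian.

Local Open Scope group_scope.

Variables (gT : finGroupType) (G A : {group gT}).
Hypothesis abA : abelian A.
Hypothesis properA : A \proper G.
Hypothesis maxA : forall H : {group gT},
  A \subset H -> H \subset G -> H :=: A \/ H :=: G.
Hypothesis nnA : ~~ (A <| G).

Let sAG : A \subset G := proper_sub properA.
Local Notation Z := 'C_A(G).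
Local Notation X := (class_support (A :\: Z) G).

Lemma norm_maximal_abelian : 'N_G(A) = A.
Proof.
have [||//|eG] := maxA (H := 'N_G(A)); rewrite ?subsetIl ?subsetI ?sAG ?normG //.
by case/negP: nnA; rewrite /normal sAG; apply/setIidPl.
Qed.

(** [A] and [A :^ g] generate [G] by maximality; both are abelian and centralise their
    intersection. *)
Lemma meet_conj_maximal_abelian g : g \in G -> g \notin A -> A :&: A :^ g \subset Z.
Proof.
move=> Gg nAg; rewrite subsetI subsetIl.
have nAJ : ~~ (A :^ g \subset A).
  apply: contra nAg => sAgA; rewrite -norm_maximal_abelian inE Gg inE.
  by [].
have [||eA|eG] := maxA (H := A <*> A :^ g); rewrite ?joing_subl ?join_subG ?sAG //=.
- by rewrite conj_subG.
- by case/negP: nAJ; have := joing_subr A (A :^ g); rewrite [_ <*> _]eA.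
rewrite -[gval G]eG centY subsetI; apply/andP; split.
  exact: subset_trans (subsetIl _ _) abA.
apply: subset_trans (subsetIr _ _) _.
by rewrite -/(abelian (A :^ g)) abelianJ.
Qed.

(** The Frobenius property of [G / Z] with complement [A / Z], expressed without quotients. *)
Lemma normedTI_maximal_abelian : normedTI (A :\: Z) G A.
Proof.
apply/normedTI_P; split.
- rewrite setD_eq0; apply/negP=> sAZ; case/negP: nnA.
  by rewrite /normal sAG cents_norm // centsC (subset_trans sAZ) // subsetIr.
- rewrite subsetI sAG; apply: subset_trans abA _.
  exact: subset_trans (centS (subsetDl _ _)) (cent_sub _).
move=> g Gg; apply: contraR => nAg; rewrite -setI_eq0 -subset0.
apply/subsetP=> x /setIP[/setDP[Ax nZx]]; rewrite mem_conjg => /setDP[Agx _].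
case/negP: nZx; apply: (subsetP (meet_conj_maximal_abelian Gg nAg)).
by rewrite inE Ax mem_conjg.
Qed.

(** [m ^ e = m * [~ m, e]] stays in [A :\: Z], and only elements of [A] conjugate a member of this
    set into it. *)
Lemma comm_center_maximal_abelian e m :
  e \in G -> m \in A :\: Z -> [~ m, e] \in Z -> e \in A.
Proof.
move=> Ge; rewrite inE => /andP[nZm Am] Zme.
have /normedTI_memJ_P[_ _ memJ] := normedTI_maximal_abelian.
have Am1 : m \in A :\: Z by rewrite inE nZm.
rewrite -(memJ m e) // -[m ^ e](mulKVg m) -commgEl inE groupMr // nZm.
by rewrite groupM // (subsetP (subsetIl A 'C(G))).
Qed.

(* The right-hand side does not depend on [H]; in particular the Frobenius kernel
   is seen to be a group without Frobenius' theorem. *)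
Lemma maximal_abelian_kernel (H : {group gT}) :
  H \subset G -> #|H| = #|G : A| ->
  (forall a g, a \in A -> g \in G -> a ^ g \in H -> a = 1) ->
  Z * H = G :\: X.
Proof.
move=> sHG cH tiH; apply/eqP.
have sXG : X \subset G.
  by rewrite class_support_sub_norm ?normG // (subset_trans (subsetDl _ _)).
have tiZH : Z :&: H = 1.
  apply/trivgP/subsetP=> z /setIP[/setIP[Az _] Hz]; rewrite inE.
  by apply/eqP/(tiH z 1); rewrite ?group1 ?conjg1.
have cZ := subset_leq_card (subsetIl A 'C(G)).
have cX : #|X| = ((#|A| - #|Z|) * #|G : A|)%N.
  rewrite (card_support_normedTI normedTI_maximal_abelian) cardsD.
  by rewrite (setIidPr _) // subsetIl.
(* Both sides have [#|Z| * #|G : A|] elements, so one inclusion suffices. *)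
rewrite eqEcard; apply/andP; split; last first.
  rewrite TI_cardMg // cardsD (setIidPr sXG) cX cH -(Lagrange sAG).
  by rewrite -mulnBl subKn.
apply/subsetP=> _ /mulsgP[z h Zz Hh ->]; rewrite inE.
have /setIP[Az /centP cz] := Zz.
rewrite groupM ?(subsetP sHG h) ?(subsetP sAG z) // andbT.
apply/negP=> /imset2P[m g /setDP[Am nZm] Gg eq_zh].
have eh : (z^-1 * m) ^ g = h.
  by rewrite conjMg -eq_zh conjVg (conjg_fixP _) ?mulKg //; apply/commgP/cz.
have /eqP : z^-1 * m = 1 by apply: (tiH _ g); rewrite ?eh // groupM ?groupV.
by rewrite -eq_mulVg1 => /eqP ez; case/negP: nZm; rewrite -ez.
Qed.

(** For [m] in [A :\: Z], the map [e |-> [~ e, m]] is an endomorphism of [E]. Its image [F] is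
    nontrivial, meets [A] trivially and is [A]-invariant, as [A] centralises [m]; [O] is the
    [p]-torsion of [F] for a prime [p] dividing [#|F|]. *)
Lemma maximal_abelian_torsion (E : {group gT}) :
  E <| G -> abelian E -> E :&: A = Z -> E :!=: Z ->
  exists2 p, prime p & exists O : {group gT}, [/\ O \subset E, A \subset 'N(O),
    O :&: A = 1, O :!=: 1 & {in O, forall f, f ^+ p = 1}].
Proof.
move=> /andP[sEG nEG] abE EA neZ.
have /set0Pn[m Zm] : A :\: Z != set0 by case/normedTI_P: normedTI_maximal_abelian.
have Am : m \in A by case/setDP: Zm.
have comE := centsP abE.
have EJ a e : a \in A -> e \in E -> e ^ a \in E.
  by move=> Aa Ee; rewrite memJ_norm // (subsetP nEG) // (subsetP sAG).
pose F := [set commg e m | e in E].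
have sFE : F \subset E.
  by apply/subsetP=> _ /imsetP[e Ee ->]; rewrite commgEl groupM ?groupV ?EJ.
have gF : group_set F.
  apply/group_setP; split; first by apply/imsetP; exists 1; rewrite ?comm1g.
  move=> _ _ /imsetP[x Ex ->] /imsetP[y Ey ->].
  apply/imsetP; exists (x * y); rewrite ?groupM // !commgEl invMg conjMg.
  move: (x ^ m) (y ^ m) (EJ m x Am Ex) => u v Eu.
  have c : commute (x^-1 * u) y^-1 by apply: comE; rewrite ?groupM ?groupV.
  by rewrite mulgA c !mulgA.
have FA : F :&: A \subset [1].
  apply/subsetP=> _ /setIP[/imsetP[e Ee ->] Ax].
  have Zx : [~ e, m] \in Z.
    by rewrite -EA inE Ax (subsetP sFE) //; apply/imsetP; exists e.
  have Ae : e \in A.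
    apply: (comm_center_maximal_abelian (subsetP sEG _ Ee) Zm).
    by rewrite -invgR groupV.
  by rewrite inE; apply/commgP/(centsP abA).
have [e Ee nZe] : exists2 e, e \in E & e \notin Z.
  by apply/subsetPn; apply: contra neZ => sEZ; rewrite eqEsubset sEZ -EA subsetIl.
have nAe : e \notin A by apply: contra nZe => Ae; rewrite -EA inE Ee.
have F1 : #|F| != 1%N.
  apply: contra nAe => /eqP cF.
  have F1 : Group gF :=: 1 by apply: card_le1_trivg; rewrite /= cF.
  apply: (comm_center_maximal_abelian (subsetP sEG _ Ee) Zm).
  have : [~ e, m] \in F by apply/imsetP; exists e.
  rewrite -[F]/(gval (Group gF)) F1 inE => /eqP c1.
  by rewrite -invg_comm c1 invg1 group1.
have F_gt1 : (1 < #|F|)%N by rewrite ltn_neqAle eq_sym F1 (cardG_gt0 (Group gF)).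
set p := pdiv #|F|.
have [f Ff ordf] : {f | f \in F & #[f] = p} := Cauchy (G := Group gF) (pdiv_prime F_gt1) (pdiv_dvd #|F|).
pose O := [set x in F | x ^+ p == 1].
have gO : group_set O.
  apply/group_setP; split; first by rewrite inE (group1 (Group gF)) expg1n /=.
  move=> x y; rewrite !inE => /andP[Fx /eqP xp] /andP[Fy /eqP yp].
  rewrite (groupM (G := Group gF)) //=.
  have c : commute x y by apply: comE; apply: (subsetP sFE).
  by rewrite expgMn ?xp ?yp ?mul1g.
exists p; first exact: pdiv_prime.
exists (Group gO); split.
- by apply: subset_trans sFE; apply/subsetP=> x; rewrite inE => /andP[].
- apply/subsetP=> a Aa; rewrite inE; apply/subsetP=> x; rewrite mem_conjg !inE.
  case/andP=> /imsetP[y Ey ey]; rewrite -conjXg conjg_eq1 => xp; rewrite xp andbT.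
  apply/imsetP; exists (y ^ a); first exact: EJ.
  have ma : m ^ a = m by apply/conjg_fixP/commgP/(centsP abA).
  by rewrite -[x](conjgKV a) ey conjRg ma.
- by apply/trivgP; apply: subset_trans FA; apply: setSI; apply/subsetP=> x; rewrite inE => /andP[].
- apply/trivgPn; exists f; first by rewrite inE Ff /= -ordf expg_order.
  by rewrite -order_gt1 ordf prime_gt1 // pdiv_prime.
by move=> x; rewrite inE => /andP[_ /eqP].
Qed.

End MaximalAbelian.

(** * Overgroups of the regular representation *)

Section IndexTwo.

Local Open Scope group_scope.

Variables (gT : finGroupType) (M : {group gT}).
Hypothesis indexM : #|[set: gT] : M| = 2%N.

Lemma card_index2 : #|gT| = (2 * #|M|)%N.
Proof. by rewrite -cardsT -(Lagrange (subsetT M)) indexM mulnC. Qed.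

Lemma lcoset_index2 x : x \notin M -> x *: M = ~: M.
Proof.
move=> nMx; apply/eqP; rewrite eqEcard card_lcoset cardsCs setCK card_index2.
rewrite mul2n -addnn addKn leqnn andbT; apply/subsetP=> _ /lcosetP[m Mm ->].
by rewrite inE groupMr.
Qed.

Lemma mem_divl_index2 x y : (x^-1 * y \in M) = ((x \in M) == (y \in M)).
Proof.
have [Mx|nMx] := boolP (x \in M); first by rewrite groupMl ?groupV //; case: (y \in M).
by rewrite -mem_lcoset lcoset_index2 // inE; case: (y \in M).
Qed.

Lemma mem_mul_index2 x y : (x * y \in M) = ((x \in M) == (y \in M)).
Proof. by rewrite -{1}[x]invgK mem_divl_index2 groupV. Qed.

End IndexTwo.

(** * Right translations as permutations *)

Section RightRegular.

Local Open Scope group_scope.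

Variable gT : finGroupType.

Definition rmul : gT -> {perm gT} := actperm 'R.

Lemma rmulE a x : rmul a x = x * a. Proof. exact: actpermE. Qed.

Lemma rmulV a : rmul a^-1 = (rmul a)^-1.
Proof.
by apply/permP=> x; apply: (@perm_inj _ (rmul a)); rewrite permKV !rmulE mulgKV.
Qed.

Lemma rmul_inj : injective rmul.
Proof. by move=> a b /permP/(_ 1); rewrite !rmulE !mul1g. Qed.

Definition rmulg (M : {group gT}) : {group {perm gT}} := (actperm 'R @* M)%G.

Lemma mem_rmulg (M : {group gT}) a : (rmul a \in rmulg M) = (a \in M).
Proof.
apply/idP/idP => [/morphimP[b _ Mb /rmul_inj ->] // | Ma].
by apply: mem_morphim; rewrite ?inE.
Qed.

Lemma rmulgP (M : {group gT}) s :
  reflect (exists2 a, a \in M & s = rmul a) (s \in rmulg M).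
Proof.
by apply: (iffP idP) => [/morphimP[a _ Ma ->] | [a Ma ->]]; [exists a | rewrite mem_rmulg].
Qed.

Lemma card_rmulg (M : {group gT}) : #|rmulg M| = #|M|.
Proof.
rewrite -(card_imset M rmul_inj); apply: eq_card => s.
by apply/rmulgP/imsetP => [] [a]; exists a.
Qed.

Lemma abelian_rmulg (M : {group gT}) : abelian M -> abelian (rmulg M).
Proof. exact: morphim_abelian. Qed.

End RightRegular.

(** * Non-normal overgroups and their shifts *)

Section NonNormal.

Local Open Scope group_scope.

Variables (gT : finGroupType) (M : {group gT}).
Hypotheses (abM : abelian M) (indexM : #|[set: gT] : M| = 2%N).
Variable G : {group {perm gT}}.
Let A := rmulg M.
Hypothesis properA : A \proper G.
Hypothesis maxA : forall H : {group {perm gT}},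
  A \subset H -> H \subset G -> H :=: A \/ H :=: G.
Hypothesis nnA : ~~ (A <| G).
Hypothesis stabM : forall g x, g \in G -> (g x \in M) = (x \in M).

Let sAG : A \subset G := proper_sub properA.
Let abA : abelian A := abelian_rmulg abM.
Local Notation Z := ('C_A(G)).

(** Pulled back from [A] to [M], because its cosets in [gT] are the blocks on which [S] is
    examined. *)
Definition central_part : {group gT} := (M :&: actperm 'R @*^-1 'C(G))%G.
Local Notation N := central_part.

Lemma mem_central a : (a \in N) = (rmul a \in Z).
Proof. by rewrite inE [in RHS]inE mem_rmulg !inE. Qed.

Lemma rmul_central g n x : g \in G -> n \in N -> g (x * n) = g x * n.
Proof.
move=> Gg; rewrite mem_central => /setIP[_ /centP/(_ g Gg) c].
by rewrite -!rmulE -!permM c.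
Qed.

Lemma central_proper : N \proper M.
Proof.
rewrite properEneq subsetIl andbT; apply: contra nnA => /eqP eNM.
rewrite /normal sAG cents_norm // centsC; apply/subsetP=> _ /rmulgP[a Ma ->].
by have : a \in N by [rewrite eNM]; rewrite mem_central => /setIP[].
Qed.

Lemma orbit_index2 x : orbit 'P G x = x *: M.
Proof.
apply/setP=> y; rewrite mem_lcoset mem_divl_index2 //; apply/orbitP/eqP.
  by case=> g Gg <-; rewrite /= apermE stabM.
move=> exy; exists (rmul (x^-1 * y)); last by rewrite /= apermE rmulE mulKVg.
by apply: (subsetP sAG); rewrite mem_rmulg mem_divl_index2 // exy.
Qed.

Local Notation Gx x := 'C_G[(x : gT) | 'P].

Lemma card_stab_index2 x : #|Gx x| = #|G : A|.
Proof.
have m0 : (0 < #|M|)%N by apply: cardG_gt0.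
apply/eqP; rewrite -(eqn_pmul2l m0) -{1}(card_lcoset M x) -orbit_index2.
by rewrite card_orbit_in_stab ?subsetT // -(Lagrange sAG) card_rmulg.
Qed.

Local Notation K := (G :\: class_support (A :\: Z) G).

(** A conjugate of a translation that fixes a point is trivial, so stabilisers satisfy the
    hypotheses of [maximal_abelian_kernel]. *)
Lemma kernel_stab x : Z * Gx x = K.
Proof.
apply: maximal_abelian_kernel; rewrite ?subsetIl ?card_stab_index2 //.
move=> s g /rmulgP[a Ma ->] Gg /setIP[_ /astab1P fx].
have : aperm (aperm x g^-1) (rmul a) = aperm x g^-1.
  by apply: (@perm_inj _ g); move: fx; rewrite /= /aperm conjgE !permM permKV.
rewrite /aperm rmulE -[X in _ = X]mulg1 => /mulgI ->.
by apply/permP=> y; rewrite rmulE mulg1 perm1.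
Qed.

(** The preimage of the Frobenius kernel of [G / Z]; by [kernel_stab] any other point would give the
    same group. *)
Definition kernel : {group {perm gT}} := (Z <*> Gx 1%g)%G.
Local Notation E := kernel.

Lemma kernelE : E :=: K.
Proof.
rewrite -(kernel_stab 1) /= cent_joinEr //.
by rewrite (subset_trans (subsetIl _ _)) // centsC subsetIr.
Qed.

Lemma kernel_normal : E <| G.
Proof.
rewrite /normal kernelE subsetDl /= normsD ?normG //.
exact: class_support_norm.
Qed.

Lemma kernelIA : E :&: A = Z.
Proof.
apply/eqP; rewrite eqEsubset; apply/andP; split; last first.
  by rewrite subsetI subsetIl joing_subl.
apply/subsetP=> s /setIP[]; rewrite kernelE => /setDP[Gs nXs] As.
apply: contraR nXs => nZs; apply/imset2P; exists s 1; rewrite ?conjg1 ?group1 //.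
exact/setDP.
Qed.

Lemma kernel_neq : E :!=: Z.
Proof.
apply/negP=> /eqP eEZ; have := indexg_gt1 G A.
have -> : #|G : A| = 1%N; last by rewrite proper_subn.
suff triv : Gx 1%g \subset [1] by rewrite -(card_stab_index2 1) (trivgP triv) cards1.
apply/subsetP=> s Gs.
have : s \in Z by rewrite -eEZ (subsetP (joing_subr _ _)).
case/setIP=> /rmulgP[a Ma es] _; case/setIP: Gs => _ /astab1P.
rewrite es /= apermE rmulE mul1g => ->; rewrite inE.
by apply/eqP/permP=> y; rewrite rmulE mulg1 perm1.
Qed.

Lemma kernelG e : e \in E -> e \in G.
Proof. by have /andP[/subsetP sEG _] := kernel_normal; exact: sEG. Qed.

Definition shift (x : gT) (e : {perm gT}) := x^-1 * e x.

Lemma shiftE x (e : {perm gT}) : e x = x * shift x e. Proof. by rewrite mulKVg. Qed.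

(** Write [e] as [z * h] with [z] in [Z] and [h] fixing this very [x]: then [e] moves [x] as [z]
    does. *)
Lemma mem_shift x e : e \in E -> shift x e \in N.
Proof.
rewrite kernelE -(kernel_stab x) => /mulsgP[z h Zz /setIP[Gh /astab1P hx] ->].
have /setIP[/rmulgP[a Ma ez] /centP/(_ h Gh) c] := Zz.
move: hx; rewrite /= apermE => hx.
by rewrite /shift c permM hx ez rmulE mulKg mem_central -ez.
Qed.

Lemma central_comm a b : a \in N -> b \in N -> commute a b.
Proof.
have sNM := subsetIl M (actperm 'R @*^-1 'C(G)).
by move=> Na Nb; apply: (centsP abM); apply: (subsetP sNM).
Qed.

Lemma shift_mul x n e : e \in E -> n \in N -> e (x * n) = x * n * shift x e.
Proof.
move=> Ee Nn; rewrite rmul_central ?kernelG // shiftE.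
have c := central_comm Nn (mem_shift x Ee).
by rewrite -(mulgA x n) c -(mulgA x (shift x e)).
Qed.

Lemma shiftM x e f : e \in E -> f \in E -> shift x (e * f) = shift x e * shift x f.
Proof.
move=> Ee Ef; rewrite {1}/shift permM (shiftE x e) shift_mul ?mem_shift //.
by rewrite -mulgA mulKg.
Qed.

(** An element of [E] is determined by its shifts, which multiply in the abelian group [N]. *)
Lemma kernel_abelian : abelian E.
Proof.
apply/centsP=> e Ee f Ef; apply/permP=> x.
rewrite !(shiftE x (_ * _)) !shiftM //; congr (_ * _).
by apply: central_comm; apply: mem_shift.
Qed.

Lemma shiftJ x m e : shift (x * m) (e ^ rmul m) = m^-1 * shift x e * m.
Proof. by rewrite /shift conjgE !permM -rmulV !rmulE mulgK invMg !mulgA. Qed.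

Lemma shiftJ_central x m e : m \in M -> e \in E -> shift (x * m) (e ^ rmul m) = shift x e.
Proof.
move=> Mm Ee; rewrite shiftJ -mulgA.
have sNM := subsetIl M (actperm 'R @*^-1 'C(G)).
by rewrite (centsP abM (shift x e) _ m) ?mulKg // (subsetP sNM) ?mem_shift.
Qed.

Lemma shift_inv x e : e \in E -> shift x e^-1 = (shift x e)^-1.
Proof.
move=> Ee; apply: (mulgI (shift x e)); rewrite -shiftM ?groupV // !mulgV.
by rewrite /shift perm1 mulVg.
Qed.

Lemma shift_expg x e i : e \in E -> shift x (e ^+ i) = shift x e ^+ i.
Proof.
move=> Ee; elim: i => [|i IH]; first by rewrite !expg0 /shift perm1 mulVg.
by rewrite !expgS shiftM ?groupX // IH.
Qed.

(* If two cosets of [N] in the complement of [M] both move in step with [1]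
   modulo [L], then [shift y] takes values in [L] on the commutators
   [~ f, rmul m], and these exhaust [O]. *)
Lemma shift_trivial (O : {group {perm gT}}) (L : {group gT}) y m :
    O \subset E -> A \subset 'N(O) -> O :&: A = 1 -> L \subset N ->
    y \notin M -> m \in M -> m \notin N ->
    {in O, forall f, shift y f * (shift 1 f)^-1 \in L} ->
    {in O, forall f, shift (y * m) f * (shift 1 f)^-1 \in L} ->
  forall x, {in O, forall f, shift x f \in L}.
Proof.
move=> /subsetP sOE nOA tiOA sLN nMy Mm nNm Ly Lym.
have abE := centsP kernel_abelian.
have OJ f a : f \in O -> a \in M -> f ^ rmul a \in O.
  by move=> Of Ma; rewrite memJ_norm // (subsetP nOA) // mem_rmulg.
pose h f := [~ f, rmul m].
(* [h f = h g] makes [f * g^-1] commute with [rmul m], which puts it in [O :&: A = 1]; so [h] is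
   injective on [O], hence onto. *)
have hO : h @: O = O.
  apply/eqP; rewrite eqEcard; apply/andP; split.
    apply/subsetP=> _ /imsetP[f Of ->].
    by rewrite /h commgEl groupM ?groupV ?OJ.
  rewrite card_in_imset // => f g Of Og; rewrite /h !commgEl => efg.
  have cfg : commute (f * g^-1) (rmul m).
    apply/commgP/conjg_fixP; rewrite conjMg conjVg.
    have -> : f ^ rmul m = f * (g^-1 * g ^ rmul m) by rewrite -efg mulKVg.
    rewrite -mulgA mulgK; congr (_ * _).
  have : f * g^-1 \in O :&: A.
    rewrite inE groupM ?groupV //=.
    apply: (comm_center_maximal_abelian abA properA maxA nnA (m := rmul m)).
    - by apply: kernelG; rewrite groupM ?groupV ?sOE.
    - by rewrite inE -mem_central nNm mem_rmulg.
    - by rewrite (eqP (introT commgP (commute_sym cfg))) group1.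
  by rewrite tiOA inE -eq_mulgV1 => /eqP.
have key a b s : a \in N -> b \in N -> s \in N ->
    a * s^-1 \in L -> b * s^-1 \in L -> a^-1 * b \in L.
  move=> Na Nb Ns La Lb; have := groupM (groupVr La) Lb.
  have c : commute s (a^-1 * b) by apply: central_comm; rewrite // groupM ?groupV.
  by rewrite invMg invgK -mulgA (mulgA a^-1) mulgA c mulgK.
have Ly' : {in O, forall f, shift y f \in L}.
  move=> f; rewrite -hO => /imsetP[g Og ->].
  have Og' := OJ _ _ Og Mm; rewrite /h commgEl shiftM ?groupV ?sOE // shift_inv ?sOE //.
  apply: (key _ _ (shift 1 (g ^ rmul m))); rewrite ?mem_shift ?sOE ?Ly //.
  by rewrite -(shiftJ_central y Mm) ?sOE // Lym.
have L1 : {in O, forall f, shift 1 f \in L}.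
  by move=> f Of; rewrite -groupV -(groupMl _ (Ly' f Of)) Ly.
move=> x f Of.
(* Since [O] is normalised by [A], it is enough to know the shifts at [1] and [y], one point in each
   coset of [M]. *)
have [z [a [Ma -> Lz]]] : exists z a, [/\ a \in M, x = z * a & {in O, forall f, shift z f \in L}].
  have [Mx|nMx] := boolP (x \in M); first by exists 1, x; rewrite mul1g.
  exists y, (y^-1 * x); rewrite mulKVg; split=> //.
  by rewrite mem_divl_index2 // (negPf nMy) (negPf nMx).
rewrite -[f](conjgKV (rmul a)) shiftJ_central //.
  by apply: Lz; rewrite -rmulV OJ ?groupV.
by rewrite sOE // -rmulV OJ ?groupV.
Qed.

Theorem nonnormal_shifts :
  exists2 p, prime p & exists2 c0, [/\ c0 \in N, c0 ^+ p = 1 & c0 != 1] &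
  forall L : {group gT}, L \subset N -> c0 \notin L ->
  exists O0 : {set gT}, forall y, y \notin M -> y *: N != O0 ->
  exists2 e, e \in G /\ e 1 = 1 & exists2 c, [/\ c \in N, c ^+ p = 1 & c \notin L] &
  forall n, n \in N -> e (y * n) = y * n * c.
Proof.
have [p pr_p [O [sOE nOA tiOA ntO Op]]] := maximal_abelian_torsion abA properA maxA nnA
  kernel_normal kernel_abelian kernelIA kernel_neq.
have OE := subsetP sOE.
have shiftp x f : f \in O -> shift x f ^+ p = 1.
  by move=> Of; rewrite -shift_expg ?OE // Op // /shift perm1 mulVg.
exists p => //.
have /trivgPn[f0 Of0 ntf0] := ntO.
have [x0 fx0] : exists x, f0 x != x.
  apply/existsP; rewrite -negb_forall; apply: contra ntf0 => /forallP f0x.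
  by apply/eqP/permP=> x; rewrite perm1; apply/eqP.
exists (shift x0 f0).
  by rewrite mem_shift ?shiftp ?OE // /shift -eq_mulVg1 eq_sym.
move=> L sLN nLc0.
pose bad y := (y \notin M) && [forall f in O, shift y f * (shift 1 f)^-1 \in L].
(* The unique coset of bad points, or [set0], which is no coset, if there is none. *)
exists (if [pick y | bad y] is Some y then y *: N else set0) => y nMy neO0.
have [|] := boolP [forall f in O, shift y f * (shift 1 f)^-1 \in L].
  move=> by_y; case: pickP neO0 => [z /andP[nMz /forall_inP bz] neO0 | /(_ y)]; last first.
    by rewrite /bad nMy by_y.
  case/negP: nLc0; apply: (shift_trivial sOE nOA tiOA sLN nMz (m := z^-1 * y)) => //.
  - by rewrite mem_divl_index2 // (negPf nMz) (negPf nMy).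
  - by apply: contra neO0 => zy; apply/eqP/lcoset_eqP; rewrite mem_lcoset.
  - by rewrite mulKVg; apply/forall_inP.
case/forall_inPn=> f Of nLf.
have N1 := mem_shift 1 (OE _ Of); have Ny := mem_shift y (OE _ Of).
exists (f * rmul (shift 1 f)^-1); first split.
- apply: groupM; first by rewrite kernelG ?OE.
  by rewrite (subsetP sAG) // mem_rmulg groupV (subsetP (proper_sub central_proper)).
- by rewrite permM rmulE {1}(shiftE 1 f) mul1g mulgV.
exists (shift y f * (shift 1 f)^-1).
  split=> //; first by rewrite groupM ?groupV.
  by rewrite expgMn ?expgVn ?shiftp ?invg1 ?mulg1 //; apply: central_comm; rewrite ?groupV.
by move=> n Nn; rewrite permM rmulE shift_mul ?OE // -(mulgA (y * n)).
Qed.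

End NonNormal.

(** * Why a set fails to give a DRR *)

Section Trichotomy.

Local Open Scope group_scope.

Variables (gT : finGroupType) (M : {group gT}).
Hypotheses (abM : abelian M) (indexM : #|[set: gT] : M| = 2%N).

(** Elements outside [L] are not [1], so the order is 2 if [b] holds and at least 3 otherwise; this
    is what controls the orbit lengths. *)
Definition shifts (b : bool) (L N : {group gT}) : {set gT} :=
  [set c in N :\: L | if b then c ^+ 2 == 1 else odd #[c]].

(* [b] tells whether the translations are involutions. In that case the last
   conjunct keeps the number of subsets of a coset of [N] which are stable under
   one of the [shifts] below [2 ^ (3 * #|N| / 4)]; in the other case the orbits
   have at least 3 elements and there is nothing to require of [L]. *)
Definition admissible (b : bool) (L N : {group gT}) : bool :=
  [&& L \subset N, N \proper M & b ==> (#|shifts b L N| ^ 4 <= 2 ^ #|N|)%N].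

Lemma rmul_Aut (S : {set gT}) a : rmul a \in dgAut (Cay S).
Proof.
by apply: (subsetP (rreg_sub_Aut S)); apply/rregP; exists a => x; rewrite rmulE.
Qed.

Lemma stabilizer_mem (S : {set gT}) (e : {perm gT}) x :
  e \in dgAut (Cay S) -> e 1 = 1 -> (e x \in S) = (x \in S).
Proof. by move=> /dgAutP/(_ x 1) + e1; rewrite /Cay /= e1 invg1 !mulg1. Qed.

(** [L] is a complement of [<[c0]>] in the elementary abelian group [V] of elements with square [1],
    so half of [V] lies outside [L]. *)
Lemma split_involution (N : {group gT}) c0 : abelian N -> c0 \in N -> c0 != 1 -> c0 ^+ 2 = 1 ->
  exists L : {group gT}, [/\ L \subset N, c0 \notin L & (#|shifts true L N| ^ 4 <= 2 ^ #|N|)%N].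
Proof.
move=> abN Nc0 ntc0 c02; pose V := Group (group_Ldiv 2 abN).
have abV : 2.-abelem V.
  apply/abelemP=> //; split; first exact: abelianS (subsetIl _ _) abN.
  by move=> x /LdivP[].
have Vc0 : <[c0]> \subset V by rewrite cycle_subG; apply/LdivP.
have /splitsP[L /complP[tiL defV]] := abelem_splits abV Vc0.
have sLV : L \subset V by rewrite -defV mulG_subr.
have sVN : V \subset N := subsetIl _ _.
have cV : #|V| = (2 * #|L|)%N.
  by rewrite -defV TI_cardMg // -orderE (nt_prime_order (p := 2)).
have cS : #|shifts true L N| = #|L|.
  have -> : shifts true L N = V :\: L.
    by apply/setP=> x; rewrite !inE -andbA.
  by rewrite cardsD (setIidPr sLV) cV mul2n -addnn addnK.
exists L; split; first exact: subset_trans sLV sVN.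
  apply: contra ntc0 => Lc0; rewrite -in_set1 -[[set 1]]tiL inE Lc0 andbT.
  exact: cycle_id.
have [r cL] := p_natP (pgroupS sLV (abelem_pgroup abV)).
have := subset_leq_card sVN; rewrite cV cS cL -expnS -expnM => leN.
rewrite leq_exp2l // (leq_trans _ leN) //.
(* [4 * r <= 2 ^ r.+1], with equality at [r = 1] and [r = 2]. *)
elim: (r) => // [] [|[|q]] // IH; rewrite expnS; lia.
Qed.

(** By normality [g] conjugates a translation by an element of [M] to another one, which evaluation
    at [1] identifies. *)
Lemma normal_semilinear (G : {group {perm gT}}) g x m :
  rmulg M <| G -> g \in G -> g 1 = 1 -> m \in M -> g (x * m) = g x * g m.
Proof.
case/andP=> _ nAG Gg g1 Mm.
have : (rmul m) ^ g \in rmulg M by rewrite memJ_norm ?(subsetP nAG) ?mem_rmulg.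
case/rmulgP=> a _ e.
have ga y : g (y * m) = g y * a.
  by rewrite -!rmulE -e conjgE !permM permK.
by rewrite ga -[m in RHS]mul1g ga g1 mul1g.
Qed.

(** Arcs join the two cosets of [M], before and after [e], so left multiplication by elements of [S]
    does not affect whether [e] keeps a point in its coset. The multipliers with this property form
    a group [H] containing [M] and [s0]. *)
Lemma connected_stab (S : {set gT}) (e : {perm gT}) s0 :
  S \subset ~: M -> s0 \in S -> M \subset <<S>> ->
  e \in dgAut (Cay S) -> e 1 = 1 -> forall x, (e x \in M) = (x \in M).
Proof.
move=> /subsetP SM Ss0 sMS /dgAutP Ae e1.
pose X x := (e x \in M) == (x \in M).
pose H := [set r | [forall x, X (r * x) == X x]].
have gH : group_set H.
  apply/group_setP; split; first by rewrite inE; apply/forallP=> x; rewrite mul1g.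
  move=> a b; rewrite !inE => /forallP Ha /forallP Hb; apply/forallP=> x.
  by rewrite -mulgA (eqP (Ha _)) Hb.
have sSH : <<S>> \subset Group gH.
  rewrite gen_subG; apply/subsetP=> s Ss; rewrite inE; apply/forallP=> x.
  have Ms : s \notin M by have := SM s Ss; rewrite inE.
  have /SM : e (s * x) * (e x)^-1 \in S.
    by have := Ae (s * x) x; rewrite /Cay /= mulgK => ->.
  rewrite inE mem_mul_index2 // groupV /X mem_mul_index2 // (negPf Ms).
  by case: (e _ \in M); case: (e x \in M); case: (x \in M).
have HX x : x \in H -> X x.
  by rewrite inE => /forallP/(_ 1); rewrite mulg1 /X e1 eqxx => /eqP.
move=> x; apply/eqP/HX.
have [Mx|nMx] := boolP (x \in M).
  by apply: (subsetP sSH); apply: (subsetP sMS).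
rewrite -[x](mulKVg s0); apply: (groupM (G := Group gH)); apply: (subsetP sSH).
  by rewrite mem_gen.
apply: (subsetP sMS); rewrite mem_divl_index2 // (negPf nMx).
by have := SM s0 Ss0; rewrite inE => /negPf ->.
Qed.

Variant nonDRR_spec (S : {set gT}) : Prop :=
| NonDRRcoset (D : {group gT}) y of D \proper M & y \notin M & S \subset y *: D
| NonDRRaffine (g : {perm gT}) of g != 1 & g 1 = 1 &
    (forall x, (g x \in M) = (x \in M)) &
    (forall x m, m \in M -> g (x * m) = g x * g m) &
    (forall x, (g x \in S) = (x \in S))
| NonDRRshift b (L N : {group gT}) y0 of admissible b L N & y0 \notin M &
    (forall y, y \notin M -> y *: N != y0 *: N ->
      exists2 c, c \in shifts b L N & forall x, x \in y *: N -> (x * c \in S) = (x \in S)).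

Lemma nonDRR_cases (S : {set gT}) :
  S \subset ~: M -> S != set0 -> ~~ is_DRR S -> nonDRR_spec S.
Proof.
move=> SM /set0Pn[s0 Ss0] nDRR.
have nMs0 : s0 \notin M by have := subsetP SM s0 Ss0; rewrite inE.
(* [S] generates the whole group exactly when [D] is [M]. *)
pose D := (<<S>> :&: M)%G.
have SD : S \subset s0 *: D.
  apply/subsetP=> s Ss; rewrite mem_lcoset inE groupM ?groupV ?mem_gen //=.
  rewrite mem_divl_index2 // (negPf nMs0).
  by have := subsetP SM s Ss; rewrite inE => /negPf ->.
have [pD|] := boolP (D \proper M); first exact: (NonDRRcoset pD nMs0 SD).
rewrite properEneq subsetIr andbT negbK => /eqP eD.
have sMS : M \subset <<S>> by rewrite -eD subsetIl.
pose Ap := (dgAut_group (Cay S) :&: 'N(M | 'P))%G.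
have stabAp g x : g \in Ap -> (g x \in M) = (x \in M).
  by move=> /setIP[_ Ng]; have := astabs_act x Ng; rewrite /= apermE.
have AutAp g : g \in Ap -> g \in dgAut (Cay S) by case/setIP.
have sMAp : rmulg M \subset Ap.
  apply/subsetP=> _ /rmulgP[a Ma ->]; rewrite inE rmul_Aut !inE.
  by apply/subsetP=> x Mx; rewrite inE /= apermE rmulE groupM.
have pMAp : rmulg M \proper Ap.
  rewrite properE sMAp; have : ~~ (dgAut (Cay S) \subset rreg gT).
    by apply: contra nDRR => sAR; rewrite /is_DRR eqEsubset sAR rreg_sub_Aut.
  (* An automorphism outside the regular group is corrected by a translation to fix [1]. *)
  case/subsetPn=> a Aa nRa; pose e := a * rmul (a 1)^-1.
  have Ae : e \in dgAut (Cay S) by rewrite (groupM (G := dgAut_group _)) ?rmul_Aut.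
  have e1 : e 1 = 1 by rewrite permM rmulE mulgV.
  apply/subsetPn; exists e.
    rewrite inE Ae !inE; apply/subsetP=> x Mx.
    by rewrite inE /= apermE (connected_stab SM Ss0 sMS Ae e1).
  apply: contra nRa => /rmulgP[b _ eb].
  apply/rregP; exists (a 1) => x.
  have b1 : b = 1 by rewrite -e1 eb rmulE mul1g.
  by rewrite -[LHS](mulgKV (a 1)) -[a x * (a 1)^-1]rmulE -permM -/e eb b1 rmulE mulg1.
(* A minimal overgroup is taken to make [rmulg M] maximal in it. *)
pose P (H : {set {perm gT}}) := (rmulg M \proper H) && (H \subset Ap).
have [|G minG sGAp] := @mingroup_exists _ P Ap; first by rewrite /P pMAp subxx.
have [/andP[pMG _] Gmin] := mingroupP minG.
have maxM (H : {group {perm gT}}) : rmulg M \subset H -> H \subset G -> H :=: rmulg M \/ H :=: G.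
  move=> sMH sHG; have [->|neH] := eqVneq (H : {set {perm gT}}) (rmulg M); first by left.
  by right; apply: Gmin; rewrite // /P (subset_trans sHG) // properEneq eq_sym neH sMH.
have stabG g x : g \in G -> (g x \in M) = (x \in M).
  by move=> Gg; apply: stabAp; apply: (subsetP sGAp).
have AutG g : g \in G -> g \in dgAut (Cay S).
  by move=> Gg; apply: AutAp; apply: (subsetP sGAp).
have [nM|nnM] := boolP (rmulg M <| G).
  have /properP[sMG [g0 Gg0 nMg0]] := pMG.
  have Ma : g0 1 \in M by rewrite stabG ?group1.
  pose g := g0 * rmul (g0 1)^-1.
  have Gg : g \in G by rewrite groupM // (subsetP sMG) // mem_rmulg groupV.
  have g1 : g 1 = 1 by rewrite permM rmulE mulgV.
  have ntg : g != 1.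
    apply: contra nMg0 => /eqP eg.
    by rewrite -[g0](mulgK (rmul (g0 1)^-1)) -/g eg mul1g groupV mem_rmulg groupV.
  apply: (NonDRRaffine ntg g1) => x; first exact: stabG.
    by move=> m Mm; apply: normal_semilinear nM _ _ _.
  by apply: stabilizer_mem; rewrite ?AutG.
have := nonnormal_shifts abM indexM pMG maxM nnM stabG.
set N := central_part M G; case=> p pr_p [c0 [Nc0 c0p ntc0] HL].
have pN : N \proper M := central_proper pMG nnM.
have [b [L [sLN nLc0 bL shp]]] : exists b (L : {group gT}), [/\ L \subset N, c0 \notin L,
    b ==> (#|shifts b L N| ^ 4 <= 2 ^ #|N|)%N &
    forall c, c \in N -> c ^+ p = 1 -> c \notin L -> c \in shifts b L N].
  (* Involutions require a large [L]; for odd [p] the trivial subgroup suffices. *)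
  have [p2|podd] := even_prime pr_p.
    rewrite p2 in c0p *; have [L [sLN nLc0 cL]] :=
      split_involution (abelianS (proper_sub pN) abM) Nc0 ntc0 c0p.
    exists true, L; split=> // c Nc /eqP cp nLc.
    by rewrite inE inE nLc Nc.
  exists false, 1%G; split=> //; first exact: sub1G.
    by rewrite inE.
  move=> c Nc /eqP cp nLc; rewrite inE inE Nc nLc /=.
  by apply: (dvdn_odd _ podd); rewrite order_dvdn.
have [O0 HO] := HL L sLN nLc0.
have adm : admissible b L N by rewrite /admissible sLN pN.
have shiftS y : y \notin M -> y *: N != O0 -> exists2 c, c \in shifts b L N &
    forall x, x \in y *: N -> (x * c \in S) = (x \in S).
  move=> nMy /(HO y nMy)[e [Ge e1] [c [Nc cp nLc] ec]].
  exists c; first exact: shp.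
  by move=> _ /lcosetP[n Nn ->]; rewrite -ec // stabilizer_mem ?AutG.
have [/existsP[y0 /andP[nMy0 /eqP eO]]|noO] := boolP [exists y, (y \notin M) && (y *: N == O0)].
  by apply: (NonDRRshift adm nMy0) => y nMy; rewrite eO; apply: shiftS.
apply: (NonDRRshift adm nMs0) => y nMy _; apply: shiftS => //.
by apply: contra noO => eO; apply/existsP; exists y; rewrite nMy.
Qed.

End Trichotomy.

(** * Counting *)

(** Bounds like [2 ^ (3 * n / 4)] are stated for fourth powers to keep exponents in [nat];
    comparison with the largest term carries them through sums. *)
Lemma expn_sum_leq (I : finType) (A : {pred I}) (F : I -> nat) k C : 0 < k ->
  (forall i, i \in A -> F i ^ k <= C) -> (\sum_(i in A) F i) ^ k <= #|A| ^ k * C.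
Proof.
move=> k0 FC; pose a := \max_(i in A) F i.
have aC : a ^ k <= C.
  rewrite /a; elim/big_ind: _ => //; first by rewrite exp0n.
  by move=> x y; rewrite /maxn; case: ifP.
apply: (@leq_trans ((#|A| * a) ^ k)); last by rewrite expnMn leq_mul2l aC orbT.
rewrite leq_exp2r // -sum_nat_const; apply: leq_sum => i Ai.
exact: leq_bigmax_cond.
Qed.

(** For [t = 3 * u + r], a further factor [2 ^ (4 * u)] makes the exponent exactly [3 * t]. In the
    induction the base at most doubles once [u >= 2], while the exponent grows by 5. *)
Lemma pred_expn4_bound u r : r < 3 -> (3 * u + r).-1 ^ 4 <= 2 ^ (5 * u + 3 * r).
Proof.
move=> r3; have base v : v < 3 -> (3 * v + r).-1 ^ 4 <= 2 ^ (5 * v + 3 * r).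
  by case: v => [|[|[|]]] //; case: r r3 => [|[|[|]]].
elim: u => [|u IH]; first exact: base.
have [/base //|u2] := ltnP u.+1 3.
apply: (@leq_trans ((2 * (3 * u + r).-1) ^ 4)); first by rewrite leq_exp2r //; lia.
rewrite expnMn; apply: leq_trans (leq_mul (leqnn _) IH) _.
by rewrite -expnD leq_exp2l //; lia.
Qed.

(** * Coding subgroups by tuples of generators *)

Section Generators.

Local Open Scope group_scope.

Variable gT : finGroupType.
Implicit Types L N : {group gT}.

(** One tuple codes two nested subgroups, the smaller generated by a prefix. *)
Definition gen_prefix k (u : {ffun 'I_k -> gT}) j : {group gT} :=
  <<[set u i | i : 'I_k & (i < j)%N]>>%G.

Lemma gen_prefix_nth k (s : seq gT) j : (size s <= k)%N ->
  gen_prefix [ffun i : 'I_k => nth 1 s i] j = <<[set x in take j s]>> :> {set gT}.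
Proof.
move=> sk; apply/eqP; rewrite eqEsubset !gen_subG; apply/andP; split.
  apply/subsetP=> _ /imsetP[i + ->]; rewrite inE ffunE => ij.
  have [lis|leis] := ltnP i (size s); last by rewrite nth_default // group1.
  by rewrite mem_gen // inE -(nth_take 1 ij) mem_nth // size_take; case: ifP.
apply/subsetP=> x; rewrite inE => /(nthP 1)[i]; rewrite size_take_min leq_min.
case/andP=> ij lis <-; rewrite nth_take //; apply: mem_gen.
have ik : (i < k)%N by apply: leq_trans lis sk.
by apply/imsetP; exists (Ordinal ik); rewrite ?inE ?ffunE.
Qed.

(** Generators of [L] are extended to generators of [N], each at least doubling the order, and
    padded with [1] to length [k]. *)
Lemma gen_prefix_pair k L N : L \subset N -> (#|N| < 2 ^ k.+1)%N ->
  exists2 u : {ffun 'I_k -> gT}, u \in ffun_on (mem N) &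
  exists j : 'I_k.+1, L = gen_prefix u j /\ N = gen_prefix u k.
Proof.
move=> sLN cN.
have [s1 s1L [c1 g1]] := gen_seq (sub1G L).
have [s2 s2N [c2 g2]] := gen_seq sLN.
have sk : (size (s1 ++ s2) <= k)%N.
  rewrite size_cat -ltnS -(ltn_exp2l _ _ (isT : (1 < 2)%N)).
  apply: leq_ltn_trans cN; rewrite expnD; apply: leq_trans c2.
  by rewrite mulnC leq_mul2l (leq_trans _ c1) ?orbT // cards1 muln1.
have gL : <<[set x in s1]>> = L.
  rewrite -[RHS]g1; apply/eqP; rewrite eqEsubset genS ?subsetUr //=.
  by rewrite gen_subG subUset sub1G subset_gen.
exists [ffun i : 'I_k => nth 1 (s1 ++ s2) i].
  apply/ffun_onP=> i; rewrite ffunE /=.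
  have [lis|leis] := ltnP i (size (s1 ++ s2)); last by rewrite nth_default // group1.
  have := mem_nth 1 lis; rewrite mem_cat => /orP[/s1L|/s2N //].
  exact: (subsetP sLN).
have s1k : (size s1 < k.+1)%N by rewrite ltnS (leq_trans _ sk) // size_cat leq_addr.
exists (Ordinal s1k); split; apply: val_inj; rewrite /= gen_prefix_nth //.
  by rewrite take_size_cat.
rewrite take_oversize // -[LHS]g2 -gL -[LHS]/(_ <*> _) joing_idl.
congr <<_>>; apply/setP=> x; by rewrite !inE mem_cat.
Qed.

End Generators.

(** * Counting the sets of each type *)

Section Counting.

Local Open Scope group_scope.

Variables (gT : finGroupType) (M : {group gT}).
Hypotheses (abM : abelian M) (indexM : #|[set: gT] : M| = 2%N).
Local Notation m := #|M|.
Local Notation l := (trunc_log 2 m).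

Lemma card_compl_index2 : #|~: M| = m.
Proof. by rewrite cardsCs setCK (card_index2 indexM) mul2n -addnn addnK. Qed.

Lemma proper_card_half (D : {group gT}) : D \proper M -> (2 * #|D| <= m)%N.
Proof.
move=> pD; rewrite -(Lagrange (proper_sub pD)) mulnC leq_pmul2l ?cardG_gt0 //.
by rewrite indexg_gt1 proper_subn.
Qed.

Lemma card_ltn_trunc_log : (m < 2 ^ l.+1)%N.
Proof. by rewrite trunc_log_ltn. Qed.

Definition coset_subsets : {set {set gT}} :=
  [set S : {set gT} | [exists D : {group gT}, exists y, [&& D \proper M, y \notin M & S \subset y *: D]]].

Lemma card_coset_subsets : (#|coset_subsets| <= m ^ l.+1 * 2 ^ (m %/ 2))%N.
Proof.
pose F (uy : {ffun 'I_l -> gT} * gT) : {set {set gT}} :=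
  let D := gen_prefix uy.1 l in if D \proper M then powerset (uy.2 *: D) else set0.
pose I := setX [set u : {ffun 'I_l -> gT} | u \in ffun_on (mem M)] (~: M).
have : (#|coset_subsets| <= #|\bigcup_(uy in I) F uy|)%N.
  apply: subset_leq_card; apply/subsetP=> S; rewrite inE.
  case/existsP=> D /existsP[y /and3P[pD nMy Sy]].
  have [|u uD [j [_ eD]]] := @gen_prefix_pair _ l D D (subxx _).
    by apply: leq_ltn_trans card_ltn_trunc_log; rewrite subset_leq_card ?proper_sub.
  apply/bigcupP; exists (u, y).
    rewrite !inE nMy andbT; apply/ffun_onP=> i.
    by have /ffun_onP/(_ i) := uD; apply: (subsetP (proper_sub pD)).
  by rewrite /F -eD pD inE.
move/leq_trans; apply; apply: leq_trans (leq_card_bigcup _ _) _.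
have -> : (m ^ l.+1 = #|I|)%N.
  by rewrite cardsX cardsE card_ffun_on card_ord card_compl_index2 expnSr.
rewrite -sum_nat_const; apply: leq_sum => uy _; rewrite /F; case: ifP => [pD|]; last by rewrite cards0.
rewrite card_powerset card_lcoset leq_exp2l // leq_divRL // mulnC.
exact: proper_card_half.
Qed.

Definition affine_maps : {set {perm gT}} :=
  [set g : {perm gT} | [&& g != 1, g 1 == 1, [forall x, (g x \in M) == (x \in M)] &
     [forall x, forall a in M, g (x * a) == g x * g a]]].

(** Such a map is determined by its values at generators of [M] and at one point [b] outside [M]. *)
Lemma card_affine_maps : (#|affine_maps| <= m ^ l.+1)%N.
Proof.
have [s sM [cs gs]] := gen_seq (sub1G M).
have /properP[_ [b _ nMb]] : M \proper [set: gT].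
  by rewrite properE subsetT -indexg_gt1 indexM.
pose k := size s; pose h (g : {perm gT}) := ([ffun i : 'I_k => g (tnth (in_tuple s) i)], g b).
have hI : {in affine_maps &, injective h}.
  move=> f g; rewrite !inE => /and4P[_ /eqP f1 _ /forallP fm] /and4P[_ /eqP g1 _ /forallP gm].
  case=> /ffunP es eb.
  have fM x a : a \in M -> f (x * a) = f x * f a.
    by move=> Ma; have /forall_inP/(_ a Ma)/eqP := fm x.
  have gM x a : a \in M -> g (x * a) = g x * g a.
    by move=> Ma; have /forall_inP/(_ a Ma)/eqP := gm x.
  pose H := [set a in M | f a == g a].
  have gH : group_set H.
    apply/group_setP; split; first by rewrite inE group1 f1 g1 eqxx.
    move=> x y; rewrite !inE => /andP[Mx /eqP ex] /andP[My /eqP ey].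
    by rewrite groupM // fM // gM // ex ey eqxx.
  have HM a : a \in M -> f a = g a.
    suff sMH : M \subset Group gH by move=> /(subsetP sMH); rewrite inE => /andP[_ /eqP].
    rewrite -{1}gs gen_subG subUset sub1G; apply/subsetP=> x; rewrite inE => sx.
    rewrite inE sM //=; have /tnthP[i ->] : x \in in_tuple s by [].
    by have := es i; rewrite !ffunE => ->.
  apply/permP=> x; have [Mx|nMx] := boolP (x \in M); first exact: HM.
  have Mbx : b^-1 * x \in M by rewrite mem_divl_index2 // (negPf nMb) (negPf nMx).
  by rewrite -[x](mulKVg b) fM // gM // eb HM.
rewrite -(card_in_imset hI).
have -> : (m ^ l.+1 = m ^ l * #|~: M|)%N by rewrite card_compl_index2 expnSr.
apply: (@leq_trans (m ^ k * #|~: M|)); last first.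
  rewrite leq_mul2r leq_pexp2l ?cardG_gt0 ?orbT //.
  by rewrite trunc_log_max // (leq_trans _ cs) // cards1 muln1.
have -> : (m ^ k * #|~: M| = #|setX [set u : {ffun 'I_k -> gT} | u \in ffun_on (mem M)] (~: M)|)%N.
  by rewrite cardsX; congr (_ * _)%N; rewrite cardsE card_ffun_on card_ord.
apply: subset_leq_card; apply/subsetP=> _ /imsetP[g + ->].
rewrite inE => /and4P[_ _ /forallP gM _]; rewrite !inE (eqP (gM b)) nMb andbT.
apply/ffun_onP=> i; rewrite ffunE /= (eqP (gM _)) sM //.
exact: mem_tnth.
Qed.

(** If [b] is a fixed point outside [M], all of them lie in [b *: C], with [C] the subgroup of fixed
    points in [M], proper since [g] is not the identity. *)
Lemma card_affine_fix g : g \in affine_maps ->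
  (#|[set x in ~: M | g x == x]| <= m %/ 2)%N.
Proof.
rewrite inE => /and4P[ntg /eqP g1 _ /forallP gm].
have gM x a : a \in M -> g (x * a) = g x * g a.
  by move=> Ma; have /forall_inP/(_ a Ma)/eqP := gm x.
have [->|/set0Pn[b]] := eqVneq [set x in ~: M | g x == x] set0; first by rewrite cards0.
rewrite !inE => /andP[nMb /eqP gb].
pose C := [set a in M | g a == a].
have gC : group_set C.
  apply/group_setP; split; first by rewrite inE group1 g1 eqxx.
  move=> x y; rewrite !inE => /andP[Mx /eqP ex] /andP[My /eqP ey].
  by rewrite groupM // gM // ex ey eqxx.
have pC : Group gC \proper M.
  rewrite properE; apply/andP; split; first by apply/subsetP=> a; rewrite inE => /andP[].
  apply: contra ntg => /subsetP sMC; apply/eqP/permP=> x; rewrite perm1.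
  have gMx a : a \in M -> g a = a by move=> /sMC; rewrite inE => /andP[_ /eqP].
  have [/gMx // |nMx] := boolP (x \in M).
  have Mbx : b^-1 * x \in M by rewrite mem_divl_index2 // (negPf nMb) (negPf nMx).
  by rewrite -[x](mulKVg b) gM // gb gMx.
rewrite leq_divRL // mulnC; apply: leq_trans (proper_card_half pC).
rewrite leq_mul2l /= -(card_lcoset (Group gC) b); apply: subset_leq_card.
apply/subsetP=> x; rewrite !inE => /andP[nMx /eqP gx].
have Mbx : b^-1 * x \in M by rewrite mem_divl_index2 // (negPf nMb) (negPf nMx).
rewrite mem_lcoset inE Mbx /=; apply/eqP/(mulgI b).
by rewrite -{1}gb -gM // mulKVg.
Qed.

Definition affine_subsets : {set {set gT}} :=
  \bigcup_(g in affine_maps) stable_subsets g (~: M).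

Lemma card_affine_subsets : (#|affine_subsets| <= m ^ l.+1 * 2 ^ ((3 * m) %/ 4))%N.
Proof.
apply: leq_trans (leq_card_bigcup _ _) _.
apply: leq_trans (leq_mul card_affine_maps (leqnn _)).
rewrite -sum_nat_const; apply: leq_sum => g Ag.
have gM x : (g x \in ~: M) = (x \in ~: M).
  by have := Ag; rewrite inE => /and4P[_ _ /forallP/(_ x)/eqP + _]; rewrite !inE => ->.
apply: leq_trans (card_stable_subsets_fix gM (card_affine_fix Ag)) _.
rewrite leq_exp2l // card_compl_index2; lia.
Qed.

(** * Sets invariant under a shift on all cosets but one *)

Section ShiftSubsets.

Variables (b : bool) (L N : {group gT}).
Hypothesis adm : admissible M b L N.
Local Notation t := #|N|.
Local Notation D := (shifts b L N).

Definition shift_stable (O : {set gT}) : {set {set gT}} :=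
  \bigcup_(c in D) stable_subsets (rmul c) O.

Lemma card_shifts : (#|D| < t)%N.
Proof.
apply: proper_card; apply/properP; split; first by apply/subsetP=> c; rewrite !inE => /andP[/andP[]].
by exists 1; rewrite ?inE group1.
Qed.

Lemma card_porbit_rmul (c x : gT) : (#[c] <= #|porbit (rmul c) x|)%N.
Proof.
rewrite orderE -(card_lcoset <[c]> x); apply: subset_leq_card.
apply/subsetP=> z /lcosetP[w /cycleP[i ->] ->].
suff -> : x * c ^+ i = (rmul c ^+ i) x by exact: mem_porbit.
by elim: i => [|i IH]; rewrite ?mulg1 ?perm1 // !expgSr permM rmulE -IH mulgA.
Qed.

Lemma card_shift_stable (y : gT) : (#|shift_stable (y *: N)| <= #|D| * 2 ^ (t %/ (if b then 2 else 3)))%N.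
Proof.
apply: leq_trans (leq_card_bigcup _ _) _; rewrite -sum_nat_const.
apply: leq_sum => c; rewrite inE => /andP[/setDP[Nc nLc] bc].
rewrite -[t](card_lcoset N y).
have Oc x : (rmul c x \in y *: N) = (x \in y *: N).
  by rewrite rmulE !mem_lcoset mulgA groupMr.
apply: (card_stable_subsets_order Oc) => [|x _]; first by case: (b).
apply: leq_trans (card_porbit_rmul c x).
have ntc : (1 < #[c])%N.
  by rewrite order_gt1; apply: contra nLc => /eqP ->; rewrite group1.
by case: (b) bc => //; case: #[c] ntc => [|[|[|]]].
Qed.

(** The exponents add up to at most [t + 2 * t] for involutions, by admissibility; for odd orders
    [pred_expn4_bound] applies. *)
Lemma shift_stable_bound4 (y : gT) : (#|shift_stable (y *: N)| ^ 4 <= 2 ^ (3 * t))%N.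
Proof.
apply: leq_trans (_ : (#|D| * 2 ^ (t %/ (if b then 2 else 3))) ^ 4 <= _)%N.
  by rewrite leq_exp2r // card_shift_stable.
have [_ _] := and3P adm; rewrite expnMn -expnM; case: (b) card_shifts => [_ /= cD|+ _].
  apply: leq_trans (leq_mul cD (leqnn _)) _; rewrite -expnD leq_exp2l //; lia.
case: #|shifts _ _ _| => [|d] dt; first by rewrite exp0n.
have -> : (3 * t = 5 * (t %/ 3) + 3 * (t %% 3) + t %/ 3 * 4)%N by lia.
rewrite [X in (_ <= X)%N]expnD leq_mul2r; apply/orP; right.
apply: leq_trans (pred_expn4_bound (t %/ 3) (ltn_pmod t (isT : (0 < 3)%N))).
by rewrite leq_exp2r //; lia.
Qed.

(** Used for one coset only, to offset the exceptional one where all [2 ^ t] subsets are allowed: in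
    fourth powers the two exponents give [4 * t + 2 * t], as much as two ordinary cosets, at the
    cost of the factor [t]. *)
Lemma shift_stable_bound1 (y : gT) : (#|shift_stable (y *: N)| <= t * 2 ^ (t %/ 2))%N.
Proof.
apply: leq_trans (card_shift_stable y) _; apply: leq_mul; first exact: ltnW card_shifts.
by rewrite leq_exp2l //; case: (b) => //; lia.
Qed.

Definition cosets_off : {set {set gT}} := [set y *: N | y in ~: M].

Lemma card_cosets_off : (#|cosets_off| * t = m)%N.
Proof.
rewrite -card_compl_index2 // -[#|~: M|]sum1_card.
rewrite (partition_big_imset (fun y => y *: N)) /= -sum_nat_const.
have [_ /proper_sub sNM _] := and3P adm.
apply/esym/eq_bigr => _ /imsetP[y nMy ->]; rewrite -(card_lcoset N y) -sum1_card.
apply: eq_bigl => x; rewrite (sameP eqP lcoset_eqP) inE andbC.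
case xyN: (x \in y *: N) => //=; apply/esym.
have Myx : y^-1 * x \in M by apply: (subsetP sNM); rewrite -mem_lcoset.
have := mem_divl_index2 indexM y x; rewrite Myx => /esym/eqP <-.
by rewrite inE in nMy.
Qed.

Definition shift_subsets (O0 : {set gT}) : {set {set gT}} :=
  [set S : {set gT} | (S \subset ~: M) && [forall (O | O \in cosets_off),
     S :&: O \in if O == O0 then powerset O else shift_stable O]].

Lemma card_shift_subsets O0 : O0 \in cosets_off ->
  (#|shift_subsets O0| ^ 4 <= t ^ 4 * 2 ^ (3 * m))%N.
Proof.
move=> PO0; have [_ pN _] := and3P adm.
have cover : ~: M \subset cover cosets_off.
  apply/subsetP=> y nMy; apply/bigcupP; exists (y *: N); last exact: lcoset_refl.
  exact: imset_f.
have := card_subsets_blocks (fun O => if O == O0 then powerset O else shift_stable O) cover.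
rewrite (bigD1 O0) //= eqxx card_powerset.
have -> : #|O0| = t by case/imsetP: PO0 => y _ ->; rewrite card_lcoset.
move=> cS.
have : (1 < #|cosets_off|)%N.
  have := proper_card_half pN; have := card_cosets_off; have := cardG_gt0 N; nia.
rewrite (cardsD1 O0) PO0 ltnS => /card_gt0P[O1]; rewrite !inE => /andP[neO1 PO1].
move: cS; rewrite (bigD1 O1) /=; last by rewrite PO1.
rewrite (negPf neO1); set V := (X in (_ <= _ * (_ * X))%N) => cS.
have cP : #|cosets_off| = #|cosets_off :\ O0 :\ O1|.+2.
  by rewrite (cardsD1 O0) PO0 (cardsD1 O1) !inE neO1 PO1.
have V4 : (V ^ 4 <= 2 ^ (3 * t * (#|cosets_off| - 2)))%N.
  rewrite /V (big_morph (fun x => x ^ 4)%N (fun x y => expnMn x y 4) (exp1n 4)).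
  rewrite expnM cP subn2 /=.
  rewrite -prod_nat_const [X in (X <= _)%N](eq_bigl (fun O => O \in cosets_off :\ O0 :\ O1)); last first.
    by move=> O; rewrite !inE; case: (O \in _); rewrite ?andbF ?andbT // andbC.
  apply: leq_prod => O; rewrite !inE => /and3P[_ neO PO]; rewrite (negPf neO).
  by case/imsetP: PO => y _ ->; apply: shift_stable_bound4.
have w1 : (#|shift_stable O1| <= t * 2 ^ (t %/ 2))%N.
  by case/imsetP: PO1 => y _ ->; apply: shift_stable_bound1.
apply: (@leq_trans ((2 ^ t * ((t * 2 ^ (t %/ 2)) * V)) ^ 4)).
  by rewrite leq_exp2r // (leq_trans cS) // leq_mul2l leq_mul2r w1 !orbT.
rewrite !expnMn -!expnM mulnCA -(mulnA (t ^ 4)%N) leq_mul2l; apply/orP; right.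
apply: leq_trans (leq_mul (leqnn _) (leq_mul (leqnn _) V4)) _.
rewrite -!expnD leq_exp2l // -card_cosets_off.
have : (1 < #|cosets_off|)%N by rewrite cP.
move: #|cosets_off| => q q2; nia.
Qed.

End ShiftSubsets.

End Counting.

(** * Assembling the bound *)

Section NonDRR.

Local Open Scope group_scope.

Variables (gT : finGroupType) (M : {group gT}).
Hypotheses (abM : abelian M) (indexM : #|[set: gT] : M| = 2%N).
Local Notation m := #|M|.
Local Notation l := (trunc_log 2 m).

Definition shift_family b : {set {set gT}} :=
  \bigcup_(LN : {group gT} * {group gT} | admissible M b LN.1 LN.2)
    \bigcup_(O0 in cosets_off M LN.2) shift_subsets M b LN.1 LN.2 O0.

Lemma card_shift_family b : (#|shift_family b| ^ 4 <= (m ^ l.+1) ^ 4 * 2 ^ (3 * m))%N.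
Proof.
pose F (LN : {group gT} * {group gT}) :=
  if admissible M b LN.1 LN.2
  then \bigcup_(O0 in cosets_off M LN.2) shift_subsets M b LN.1 LN.2 O0 else set0.
(* A proper subgroup needs at most [l.-1] generators; the factor [m] saved pays for the [l] prefix
   lengths. *)
pose k := l.-1.
pose I := setX [set u : {ffun 'I_k -> gT} | u \in ffun_on (mem M)] [set: 'I_k.+1].
pose h (uj : {ffun 'I_k -> gT} * 'I_k.+1) := (gen_prefix uj.1 uj.2, gen_prefix uj.1 k).
have : (#|shift_family b| <= #|\bigcup_(uj in I) F (h uj)|)%N.
  apply: subset_leq_card; apply/bigcupsP=> -[L N] /= adm.
  have [sLN pN _] := and3P adm.
  have cN : (#|N| < 2 ^ k.+1)%N.
    have := proper_card_half pN; have := @card_ltn_trunc_log gT M; have := cardG_gt0 N.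
    rewrite /k; case: (l) => [|l'] /=; rewrite ?expnS; lia.
  have [u uN [j [eL eN]]] := gen_prefix_pair sLN cN.
  apply/subsetP=> S SO; apply/bigcupP; exists (u, j).
    rewrite !inE andbT; apply/ffun_onP=> i; have /ffun_onP/(_ i) := uN.
    exact: (subsetP (proper_sub pN)).
  by rewrite /F /h /= -eL -eN adm.
rewrite -(leq_exp2r _ _ (isT : (0 < 4)%N)) => /leq_trans; apply.
apply: leq_trans (_ : (\sum_(uj in I) #|F (h uj)|) ^ 4 <= _)%N.
  by rewrite leq_exp2r // leq_card_bigcup.
apply: leq_trans (expn_sum_leq (C := m ^ 4 * 2 ^ (3 * m)) _ _) _ => // [uj _|].
  rewrite /F; case: ifP => [adm|_]; last by rewrite cards0.
  apply: leq_trans (_ : (\sum_(O0 in cosets_off M (h uj).2)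
      #|shift_subsets M b (h uj).1 (h uj).2 O0|) ^ 4 <= _)%N.
    by rewrite leq_exp2r // leq_card_bigcup.
  apply: leq_trans (expn_sum_leq (C := #|(h uj).2| ^ 4 * 2 ^ (3 * m)) _ _) _ => // [O0 PO|].
    exact: card_shift_subsets.
  by rewrite mulnA -expnMn (card_cosets_off indexM adm).
rewrite mulnA -expnMn leq_mul2r leq_exp2r //; apply/orP; right.
rewrite cardsX cardsE card_ffun_on cardsT !card_ord.
have m0 := cardG_gt0 M.
have : (l <= m)%N by apply: ltnW; apply: leq_trans (ltn_expl _ _) (trunc_logP _ _).
rewrite /k; case: (l) => [|l'] /= lm; first by rewrite expn0 !mul1n.
by rewrite mulnAC -expnSr [in leqRHS]expnSr leq_mul2l lm orbT.
Qed.

Definition nonDRR_sets : {set {set gT}} := [set S : {set gT} | (S \subset ~: M) && ~~ is_DRR S].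

Lemma nonDRR_sets_cover :
  nonDRR_sets \subset [set set0] :|: coset_subsets M :|: affine_subsets M
    :|: shift_family true :|: shift_family false.
Proof.
apply/subsetP=> S; rewrite inE => /andP[SM nDRR].
have [->|S0] := eqVneq S set0; first by rewrite !inE eqxx.
case: (nonDRR_cases abM indexM SM S0 nDRR) => [D y pD nMy SD|g ntg g1 gM gm gS|b L N y0 adm nMy0 HS].
- suff : S \in coset_subsets M by rewrite !in_setU => ->; rewrite !orbT.
  by rewrite inE; apply/existsP; exists D; apply/existsP; exists y; apply/and3P.
- suff : S \in affine_subsets M by rewrite !in_setU => ->; rewrite !orbT.
  apply/bigcupP; exists g; last by rewrite inE SM; apply/forallP=> x; rewrite gS.
  rewrite inE ntg g1 eqxx /=; apply/andP; split; first by apply/forallP=> x; rewrite gM.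
  by apply/forallP=> x; apply/forall_inP=> a Ma; rewrite gm.
suff : S \in shift_family b by rewrite !in_setU; case: (b) => ->; rewrite !orbT.
apply/bigcupP; exists (L, N) => //=; apply/bigcupP; exists (y0 *: N).
  by apply: imset_f; rewrite inE.
rewrite inE SM; apply/forall_inP=> _ /imsetP[y nMy ->].
rewrite inE in nMy; have [_|neO] := eqVneq; first by rewrite inE subsetIr.
have [c Dc cS] := HS y nMy neO; apply/bigcupP; exists c => //.
have Nc : c \in N by move: Dc; rewrite inE => /andP[/setDP[]].
rewrite inE subsetIr; apply/forallP=> x; rewrite rmulE !inE.
have -> : (x * c \in y *: N) = (x \in y *: N) by rewrite !mem_lcoset mulgA groupMr.
by case xO: (x \in y *: N); rewrite ?andbF // !andbT cS.
Qed.

(** The factor 5 is the number of families in the cover, [C] the largest of their cardinals. *)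
Lemma card_nonDRR_sets :
  exists2 C, (C ^ 4 <= (m ^ l.+1) ^ 4 * 2 ^ (3 * m))%N & (#|nonDRR_sets| <= 5 * C)%N.
Proof.
have m0 := cardG_gt0 M; set B := (_ * _)%N.
have maxB x y : (x ^ 4 <= B -> y ^ 4 <= B -> (maxn x y) ^ 4 <= B)%N.
  by rewrite /maxn; case: ifP.
have b0 : (#|[set set0 : {set gT}]| ^ 4 <= B)%N.
  by rewrite cards1 exp1n muln_gt0 !expn_gt0 m0.
have b1 : (#|coset_subsets M| ^ 4 <= B)%N.
  apply: (@leq_trans ((m ^ l.+1 * 2 ^ (m %/ 2)) ^ 4)).
    by rewrite leq_exp2r // card_coset_subsets.
  by rewrite /B expnMn leq_mul2l; apply/orP; right; rewrite -expnM leq_exp2l //; lia.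
have b2 : (#|affine_subsets M| ^ 4 <= B)%N.
  apply: (@leq_trans ((m ^ l.+1 * 2 ^ (3 * m %/ 4)) ^ 4)).
    by rewrite leq_exp2r // card_affine_subsets.
  by rewrite /B expnMn leq_mul2l; apply/orP; right; rewrite -expnM leq_exp2l //; lia.
have b3 := card_shift_family true; have b4 := card_shift_family false.
exists (maxn #|[set set0 : {set gT}]| (maxn #|coset_subsets M| (maxn #|affine_subsets M|
  (maxn #|shift_family true| #|shift_family false|)))); first by do 4![apply: (maxB) => //].
apply: leq_trans (subset_leq_card nonDRR_sets_cover) _.
have U (X Y : {set {set gT}}) : (#|X :|: Y| <= #|X| + #|Y|)%N by rewrite cardsU leq_subr.
apply: leq_trans (U _ _) _; apply: leq_trans (leq_add (U _ _) (leqnn _)) _.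
apply: leq_trans (leq_add (leq_add (U _ _) (leqnn _)) (leqnn _)) _.
apply: leq_trans (leq_add (leq_add (leq_add (U _ _) (leqnn _)) (leqnn _)) (leqnn _)) _.
move: #|[set set0]| #|coset_subsets M| #|affine_subsets M| #|shift_family true|
  #|shift_family false| => c0 c1 c2 c3 c4.
lia.
Qed.

Lemma card_DRR_sets :
  #|[set S : {set gT} | (S \subset [set: gT] :\: M) && is_DRR S]| = (2 ^ m - #|nonDRR_sets|)%N.
Proof.
have <- : #|powerset (~: M)| = (2 ^ m)%N by rewrite card_powerset card_compl_index2.
have /setIidPr <- : nonDRR_sets \subset powerset (~: M).
  by apply/subsetP=> S; rewrite !inE => /andP[].
rewrite -cardsD; apply: eq_card => S; rewrite !inE setTD.
by case: (S \subset _); rewrite ?andbF ?andbT ?negbK.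
Qed.

End NonDRR.

(** * Passage to real exponents *)

Import Order.TTheory GRing.Theory Num.Theory.

Local Open Scope ring_scope.

(* [2 `^ (log2 (2 * m) * log2 m)] equals [m `^ (1 + log2 m)]. *)
Lemma powR_bound (K : realType) (m c : nat) : (0 < m)%N ->
  (c ^ 4 <= (m ^ (trunc_log 2 m).+1) ^ 4 * 2 ^ (3 * m))%N ->
  c%:R <= 2 `^ (3 * (2 * m)%:R / 8 + log2 (2 * m)%:R * log2 ((2 * m)%:R / 2)) :> K.
Proof.
move=> m0 c4; set l := trunc_log 2 m in c4.
have lnge : (0 : K) < ln 2 by rewrite ln_gt0 // ltr1n.
have mR : (0 : K) < m%:R by rewrite ltr0n.
pose Y : K := 2 `^ (3 * m%:R / 4).
have Y0 : 0 <= Y by apply: powR_ge0.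
have Y4 : Y ^+ 4 = (2 ^ (3 * m))%:R.
  rewrite -powR_mulrn // -powRrM natrX -powR_mulrn ?ler0n //; congr (_ `^ _).
  by rewrite natrM divfK // pnatr_eq0.
have powlog : 2 `^ log2 m%:R = m%:R :> K.
  by rewrite /log2 /powR pnatr_eq0 /= divfK ?gt_eqF // lnK ?posrE.
have log2_2m : log2 (2 * m)%:R = 1 + log2 m%:R :> K.
  rewrite /log2 natrM lnM ?posrE ?ltr0n // mulrDl divff // gt_eqF //.
have lle : l%:R <= log2 m%:R :> K.
  rewrite /log2 ler_pdivlMr // mulr_natl -lnXn ?ltr0n // ler_ln ?posrE ?exprn_gt0 ?ltr0n //.
  by rewrite -natrX ler_nat trunc_logP.
have Xle : (m ^ l.+1)%:R <= 2 `^ (log2 (2 * m)%:R * log2 m%:R) :> K.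
  rewrite mulrC powRrM powlog log2_2m natrX -powR_mulrn ?ler0n //.
  apply: ler_powR; first by rewrite ler1n.
  by rewrite -natr1 addrC lerD2l.
have -> : (2 * m)%:R / 2 = m%:R :> K by rewrite natrM mulrC mulKf // pnatr_eq0.
have -> : 3 * (2 * m)%:R / 8 = 3 * m%:R / 4 :> K.
  by rewrite natrM; field.
rewrite powRD; last by rewrite pnatr_eq0 implybT.
rewrite -/Y mulrC; apply: le_trans (ler_wpM2r Y0 Xle).
rewrite -(@ler_pXn2r _ 4) ?nnegrE ?mulr_ge0 ?ler0n //.
by rewrite exprMn Y4 -!natrX -natrM ler_nat.
Qed.

(* The group R is the whole of the finite group type gT; K is the field of
   real numbers in which the bound is evaluated. *)
Theorem theorem1p3 (K : realType) (gT : finGroupType) (M : {group gT})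
    (abM : abelian M) (indexM : #|[set: gT] : M|%g = 2%N) :
  2 `^ (#|gT|%:R / 2)
    - 5 * 2 `^ (3 * #|gT|%:R / 8 + log2 #|gT|%:R * log2 (#|gT|%:R / 2))
  <= #|[set S : {set gT} | (S \subset [set: gT] :\: M) && is_DRR S]|%:R :> K.
Proof.
have [C C4 cC] := card_nonDRR_sets abM indexM.
rewrite (card_DRR_sets indexM) (card_index2 indexM).
have := powR_bound K (cardG_gt0 M) C4.
have -> : (2 * #|M|)%:R / 2 = #|M|%:R :> K by rewrite natrM mulrC mulKf // pnatr_eq0.
set T := 2 `^ (_ + _); rewrite powR_mulrn ?ler0n // -natrX lerBlDr.
(* Truncation in [nat] is harmless, as [#|nonDRR_sets M| <= 5 * C]. *)
move=> CT; apply: (@le_trans _ _ ((2 ^ #|M| - #|nonDRR_sets M|)%:R + 5 * C%:R)).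
  by rewrite -natrM -natrD ler_nat; lia.
by rewrite lerD2l ler_wpM2l ?ler0n.
Qed.
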